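(* Let $N$ be a lattice of rank two and let $C\subset N_{\mathbb{Q}}:=N\otimes_{\mathbb{Z}}\mathbb{Q}$ be a two-dimensional (strictly convex, rational) cone of singularity type $\frac{1}{r}(1,a-1)$, of width $w$ and local index $\ell$; write $w=n\ell+\rho$ with $n,\rho\in\mathbb{Z}_{\geq 0}$, $0\leq\rho<\ell$. Let $u,v\in N$ be the primitive lattice vectors on the rays of $C$, ordered such that $u$, $v$, and $\frac{a-1}{r}u+\frac{1}{r}v$ generate $N$. Let $m$ be a non-negative integer with $m\leq w/\ell$, and let $v_0,v_1,\ldots,v_{n+1}$ be the sequence of lattice points on the line segment $uv$ determined by $m$ and $u$ as follows: $v_0=u$ and $v_{n+1}=v$; for each $i\in\{0,\ldots,n\}$ the vector $v_{i+1}-v_i$ is a non-negative scalar multiple of $v-u$; $v_{i+1}-v_i$ has lattice length $\ell$ for every $i\in\{0,\ldots,n\}\setminus\{m\}$; and $v_{m+1}-v_m$ has lattice length $\rho$. Set $C_i:=\mathrm{cone}\{v_i,v_{i+1}\}$ for $0\leq i\leq n$. Let $\bar{a}$ be an integer satisfying $(a-1)(\bar{a}-1)\equiv 1 \pmod r$ (so that exchanging the roles of $u$ and $v$ exchanges $a$ and $\bar{a}$). Then: (1) the lattice points $v_0,\ldots,v_{n+1}$ are primitive; (2) the subcones $C_i$, $0\leq i<m$, are of singularity type $\frac{1}{\ell^2}\left(1,\frac{\ell a}{w}-1\right)$; (3) if $\rho\neq 0$ then the subcone $C_m$ is of singularity type $\frac{1}{\rho\ell}\left(1,\frac{\rho a}{w}-1\right)$;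 (4) the subcones $C_i$, $m<i\leq n$, are of singularity type $\frac{1}{\ell^2}\left(1,\frac{\ell\bar{a}}{w}-1\right)$. Moreover, the singularity type of $C_m$ depends only on $C$.
   Context: The width $w\in\mathbb{Z}_{>0}$ of $C$ is the lattice length of $v-u$, i.e. the positive integer $w$ such that $v-u$ is $w$ times a primitive vector of $N$. The local index $\ell\in\mathbb{Z}_{>0}$ of $C$ is the lattice height of the line segment $uv$ above the origin, i.e. the common value $h(u)=h(v)=\ell>0$ where $h\in\mathrm{Hom}(N,\mathbb{Z})$ is the primitive form that is constant on $uv$ and positive there. In general the lattice length of a vector $x\in N$ is the integer $k\geq 0$ such that $x$ is $k$ times a primitive vector. A two-dimensional cone has singularity type $\frac{1}{r}(p,q)$ if the corresponding affine toric surface is the cyclic quotient singularity $\mathbb{A}^2/\mu_r$, with $\varepsilon\in\mu_r$ acting by $(x,y)\mapsto(\varepsilon^p x,\varepsilon^q y)$, $p,q$ coprime to $r$; equivalently, its primitive ray generators $u',v'$ can be ordered so that $N$ is generated by $u'$, $v'$ and $\frac{p}{r}u'+\frac{q}{r}v'$. Types are considered up to equivalence: $\frac1r(1,q)$ and $\frac1r(1,q')$ are equivalent if and only if $q\equiv q'$ or $qq'\equiv 1\pmod r$. It is known that a cone of type $\frac1r(1,a-1)$ has $w=\gcd(r,a)$ and $\ell=r/\gcd(r,a)$; in particular $a/w$ and $\bar{a}/w$ are integers. *)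

(* Defs.v *)
From HB Require Import structures.
From mathcomp Require Import all_boot all_order all_algebra.

Set Implicit Arguments.
Unset Strict Implicit.
Unset Printing Implicit Defensive.

Import Order.TTheory GRing.Theory Num.Theory.
Local Open Scope ring_scope.

Definition rank_two_lattice (N : zmodType) : Prop :=
  exists e1 e2 : N, forall x : N,
    exists! c : int * int, x = e1 *~ c.1 + e2 *~ c.2.

(* iota : N -> NQ is x |-> x (x) 1 : N -> N (x)_Z Q, by the universal property
   of extension of scalars along Z -> Q. *)
Definition is_rationalization (N : zmodType) (NQ : lmodType rat)
    (iota : {additive N -> NQ}) : Prop :=
  forall (W : lmodType rat) (f : {additive N -> W}),
    (exists g : {linear NQ -> W}, forall x : N, g (iota x) = f x) /\
    (forall g g' : {linear NQ -> W},
       (forall x : N, g (iota x) = f x) ->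
       (forall x : N, g' (iota x) = f x) ->
       forall y : NQ, g y = g' y).

(* Since 0 = 0 *+ 2, primitive vectors are nonzero. *)
Definition primitive (N : zmodType) (x : N) : Prop :=
  forall (k : nat) (y : N), x = y *+ k -> k = 1%N.

(* Primitivity in the group Hom(N, Z). *)
Definition primitive_form (N : zmodType) (h : {additive N -> int}) : Prop :=
  forall (k : nat) (g : {additive N -> int}),
    (forall x : N, h x = g x *+ k) -> k = 1%N.

Definition lattice_length (N : zmodType) (x : N) (k : nat) : Prop :=
  exists2 y : N, primitive y & x = y *+ k.

Definition conic_hull (V : lmodType rat) (s : seq V) (x : V) : Prop :=
  exists2 c : nat -> rat,
    (forall i, 0 <= c i) & x = \sum_(i < size s) c i *: s`_i.

Definition cone2 (N : zmodType) (NQ : lmodType rat)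
    (iota : {additive N -> NQ}) (x y : N) : NQ -> Prop :=
  conic_hull [:: iota x; iota y].

(* Strictly convex rational polyhedral cones whose linear span is at least
   two-dimensional, hence exactly so when N has rank two. *)
Definition two_dim_cone (N : zmodType) (NQ : lmodType rat)
    (iota : {additive N -> NQ}) (C : NQ -> Prop) : Prop :=
  [/\ exists s : seq N, forall x, C x <-> conic_hull [seq iota y | y <- s] x,
      forall x, C x -> C (- x) -> x = 0
    & exists x y, [/\ C x, C y
        & forall c d : rat, c *: x + d *: y = 0 -> c = 0 /\ d = 0]].

Definition half_line (V : lmodType rat) (x y : V) : Prop :=
  exists2 c : rat, 0 <= c & y = c *: x.

(* u is the primitive lattice vector on a ray, i.e. a one-dimensional face, of
   C. A subcone F of C is a face if x + y in F forces x, y in F for x, y in C. *)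
Definition ray_generator (N : zmodType) (NQ : lmodType rat)
    (iota : {additive N -> NQ}) (C : NQ -> Prop) (u : N) : Prop :=
  [/\ primitive u, C (iota u)
    & forall x y : NQ, C x -> C y -> half_line (iota u) (x + y) ->
        half_line (iota u) x /\ half_line (iota u) y].

Definition ray_generators (N : zmodType) (NQ : lmodType rat)
    (iota : {additive N -> NQ}) (C : NQ -> Prop) (u v : N) : Prop :=
  [/\ ray_generator iota C u, ray_generator iota C v & u <> v].

(* N is generated by u, v and (p/r) u + (q/r) v; in particular the latter
   vector of NQ is a lattice vector. *)
Definition type_generates (N : zmodType) (NQ : lmodType rat)
    (iota : {additive N -> NQ}) (u v : N) (r : nat) (p q : int) : Prop :=
  exists z : N,
    iota z = (p%:~R / r%:R) *: iota u + (q%:~R / r%:R) *: iota v /\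
    forall x : N, exists i j k : int, x = u *~ i + v *~ j + z *~ k.

(* C has singularity type 1/r (p, q). *)
Definition singularity_type (N : zmodType) (NQ : lmodType rat)
    (iota : {additive N -> NQ}) (C : NQ -> Prop) (r : nat) (p q : int) : Prop :=
  [/\ two_dim_cone iota C, (0 < r)%N, coprimez p r%:Z, coprimez q r%:Z
    & exists u v : N,
        ray_generators iota C u v /\ type_generates iota u v r p q].

Definition cone_width (N : zmodType) (NQ : lmodType rat)
    (iota : {additive N -> NQ}) (C : NQ -> Prop) (w : nat) : Prop :=
  (0 < w)%N /\
  exists u v : N, ray_generators iota C u v /\ lattice_length (v - u) w.

Definition local_index (N : zmodType) (NQ : lmodType rat)
    (iota : {additive N -> NQ}) (C : NQ -> Prop) (l : nat) : Prop :=
  (0 < l)%N /\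
  exists (u v : N) (h : {additive N -> int}),
    [/\ ray_generators iota C u v, primitive_form h, h u = l%:Z & h v = l%:Z].

(* s 0, ..., s n.+1 is the sequence of lattice points on the segment uv
   determined by m and u; the values s i for i > n.+1 are irrelevant. *)
Definition subdivision (N : zmodType) (NQ : lmodType rat)
    (iota : {additive N -> NQ}) (l n rho m : nat) (u v : N)
    (s : nat -> N) : Prop :=
  [/\ s 0%N = u /\ s n.+1 = v,
      forall i, (i <= n.+1)%N -> exists2 t : rat, 0 <= t <= 1
        & iota (s i) = (1 - t) *: iota u + t *: iota v,
      forall i, (i <= n)%N -> half_line (iota (v - u)) (iota (s i.+1 - s i)),
      forall i, (i <= n)%N -> i <> m -> lattice_length (s i.+1 - s i) l
    & lattice_length (s m.+1 - s m) rho].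

(* Equality of singularity types up to the equivalence of types: the same
   symbols 1/r (p, q) apply to both cones. *)
Definition same_singularity_type (N : zmodType) (NQ : lmodType rat)
    (iota : {additive N -> NQ}) (C C' : NQ -> Prop) : Prop :=
  forall (r : nat) (p q : int),
    singularity_type iota C r p q <-> singularity_type iota C' r p q.

(* Main.v *)
Require Import Defs.
From HB Require Import structures.
From mathcomp Require Import all_boot all_order all_algebra.
From mathcomp Require Import ring zify.
(** The lattice N has a basis adapted to the cone.  If u, v and
    z = ((a-1) u + v) / r generate N, then v = r z - (a-1) u is redundant, so
    u, z is a basis and v - u = r z - a u.  Writing v - u = w e with e
    primitive, and using that the height form is primitive and takes the value
    l at u and at v, one gets
        e = l z - c u,   a = w c,   r = w l    (cone_normal_form).
    In this basis the cone spanned by u and u + k e is immediate: its lattice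
    is generated by u and z, and k l z = (k c - 1) u + (u + k e), so its type is
    1/(kl) (1, kc - 1) (cone_over_step).

    The second ingredient is the shear u |-> u + j l e, z |-> z + j c e.  It
    fixes e and is unimodular (basis_shear), so for every integer j the cone
    over the segment from u + j l e to u + (j l + k) e has the same type.  The
    subdivision points v_i with i <= m are the u + i l e
    (subdivision_points): this gives their primitivity and the types of C_i for
    i < m (k = l) and i = m (k = rho), where l c = l a / w and
    rho c = rho a / w.  The points v_i with i > m are reached from the other end
    v of the segment, where the same argument applies with u and v exchanged,
    e replaced by -e and a by abar (type_generates_swap).

    Every C_m, for whichever m and order of the ends, is therefore a cone over
    a segment from u + j l e to u + (j l + rho) e for some j, and all these
    cones have one common type.  Two cones with one type in common have all
    their types in common (singularity_type_transfer), because a type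
    determines the coordinates of the lattice in terms of the ray generators,
    and the pair of ray generators of a two-dimensional cone is unique up to
    order (ray_generators_cases).

    Everything is computed with integer coordinates in N: the rational vector
    space enters only through the injectivity of iota. *)

Set Implicit Arguments.
Unset Strict Implicit.
Unset Printing Implicit Defensive.
Import Order.TTheory GRing.Theory Num.Theory.
Local Open Scope ring_scope.

(** * The rationalization of a lattice *)

(** The coordinates in a lattice basis form an additive map from N to Q x Q,
    which the universal property factors through iota; hence iota separates
    points. *)
Lemma iota_inj (N : zmodType) (NQ : lmodType rat) (iota : {additive N -> NQ}) :
  rank_two_lattice N -> is_rationalization iota -> injective iota.
Proof.
move=> [e1 [e2 eP]] univ.
have cP (x : N) : exists c : int * int, x == e1 *~ c.1 + e2 *~ c.2.
  by have [c [/eqP xE _]] := eP x; exists c.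
pose coord x := xchoose (cP x).
have coordE x : x = e1 *~ (coord x).1 + e2 *~ (coord x).2.
  exact/eqP/(xchooseP (cP x)).
have coord_uniq x c : x = e1 *~ c.1 + e2 *~ c.2 -> coord x = c.
  move=> xE; have [c0 [_ uniq0]] := eP x.
  by rewrite -(uniq0 _ (coordE x)) (uniq0 c xE).
have coordB : {morph coord : x y / x - y}.
  move=> x y; apply: coord_uniq.
  by rewrite {1}(coordE x) {1}(coordE y) /= !mulrzBr opprD addrACA.
pose f (x : N) : rat^o * rat^o := ((coord x).1%:~R, (coord x).2%:~R).
have fB : zmod_morphism f.
  by move=> x y; rewrite /f coordB /= !intrB.
pose fM := GRing.isZmodMorphism.Build N (rat^o * rat^o)%type f fB.
pose F : {additive N -> (rat^o * rat^o)%type} := HB.pack f fM.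
have [[g gE] _] := univ _ F.
move=> x y iota_xy.
have : F x = F y by rewrite -!gE iota_xy.
rewrite /F /= /f => -[/intr_inj E1 /intr_inj E2].
by rewrite (coordE x) (coordE y) E1 E2.
Qed.

Definition torsion_free (N : zmodType) : Prop :=
  forall (x : N) (k : int), k <> 0 -> x *~ k = 0 -> x = 0.

Lemma torsion_free_lattice (N : zmodType) (NQ : lmodType rat)
    (iota : {additive N -> NQ}) : injective iota -> torsion_free N.
Proof.
move=> iotaI x k /eqP k0 /(congr1 iota); rewrite raddfMz raddf0 -scaler_int.
move/eqP; rewrite scaler_eq0 intr_eq0 (negPf k0) /= => /eqP ix0.
by apply: iotaI; rewrite ix0 raddf0.
Qed.

Lemma mulIz (N : zmodType) (x y : N) (k : int) :
  torsion_free N -> k <> 0 -> x *~ k = y *~ k -> x = y.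
Proof.
move=> tf k0 E; apply/eqP; rewrite -subr_eq0; apply/eqP.
by apply: (tf _ k k0); rewrite mulrzBl E subrr.
Qed.

(** * Integer coordinates *)

(** A closed form for integer combinations: once all vectors are written in
    this form, identities in N become identities between integers, which ring
    decides. *)
Definition comb (N : zmodType) (x y : N) (i j : int) : N := x *~ i + y *~ j.

Lemma combD (N : zmodType) (x y : N) i j i' j' :
  comb x y i j + comb x y i' j' = comb x y (i + i') (j + j').
Proof. by rewrite /comb !mulrzDr addrACA. Qed.

Lemma combN (N : zmodType) (x y : N) i j :
  - comb x y i j = comb x y (- i) (- j).
Proof. by rewrite /comb opprD !mulrNz. Qed.

Lemma combMz (N : zmodType) (x y : N) i j k :
  comb x y i j *~ k = comb x y (i * k) (j * k).
Proof. by rewrite /comb mulrzDl !mulrzA. Qed.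

Lemma comb10 (N : zmodType) (x y : N) : comb x y 1 0 = x.
Proof. by rewrite /comb mulr1z mulr0z addr0. Qed.

Lemma comb01 (N : zmodType) (x y : N) : comb x y 0 1 = y.
Proof. by rewrite /comb mulr1z mulr0z add0r. Qed.

Definition combE := (combD, combN, combMz).

Definition independent (N : zmodType) (x y : N) : Prop :=
  forall i j, comb x y i j = 0 -> i = 0 /\ j = 0.

Lemma comb_inj (N : zmodType) (x y : N) i j i' j' : independent x y ->
  comb x y i j = comb x y i' j' -> i = i' /\ j = j'.
Proof.
move=> indep E.
have [|/eqP + /eqP] := indep (i - i') (j - j').
  by rewrite -combD -combN E subrr.
by rewrite !subr_eq0 => /eqP-> /eqP->.
Qed.

Lemma independentC (N : zmodType) (x y : N) :
  independent x y -> independent y x.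
Proof. by move=> I i j; rewrite /comb addrC => /I[]. Qed.

Definition generate (N : zmodType) (x y : N) : Prop :=
  forall t, exists i j, t = comb x y i j.

Definition basis (N : zmodType) (x y : N) : Prop :=
  independent x y /\ generate x y.

(** * Primitive vectors *)

Lemma primitive_nz (N : zmodType) (x : N) : primitive x -> x <> 0.
Proof. by move=> P x0; have := P 0%N 0; rewrite mul0rn => /(_ x0). Qed.

Lemma primitiveN (N : zmodType) (x : N) : primitive x -> primitive (- x).
Proof.
move=> P k y E; apply: (P k (- y)).
by rewrite mulNrn -E opprK.
Qed.

Lemma primitive_int (N : zmodType) (x y : N) (k : int) :
  primitive x -> x = y *~ k -> k = 1 \/ k = -1.
Proof.
move=> P; case: k => k E; first by left; rewrite (P k y E).
right; rewrite NegzE; congr (- _ %:Z).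
by apply: (P k.+1 (- y)); rewrite mulNrn E NegzE mulrNz.
Qed.

(** After dividing i and j by their gcd, a Bezout relation writes x and y as
    integer multiples of one and the same vector; both are primitive, so the
    two multiples are 1 or -1. *)
Lemma parallel_primitive (N : zmodType) (x y : N) (i j : int) :
  torsion_free N -> primitive x -> primitive y -> i <> 0 ->
  x *~ i = y *~ j -> x = y \/ x = - y.
Proof.
move=> tf Px Py i0 E.
have g0 : gcdz i j <> 0 by move/eqP; rewrite gcdz_eq0 => /andP[/eqP].
have [i' iE] : exists i', i = i' * gcdz i j.
  by exists (i %/ gcdz i j)%Z; rewrite divzK ?dvdz_gcdl.
have [j' jE] : exists j', j = j' * gcdz i j.
  by exists (j %/ gcdz i j)%Z; rewrite divzK ?dvdz_gcdr.
have [p [q pqE]] := Bezoutz i j.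
set g := gcdz i j in g0 iE jE pqE.
have B : p * i' + q * j' = 1.
  by apply: (mulIf (x := g)); [apply/eqP | rewrite mul1r -{2}pqE iE jE; ring].
have {}E : x *~ i' = y *~ j'.
  by apply: (mulIz tf g0); rewrite -!mulrzA -iE -jE.
have xE : x = comb x y q p *~ j'.
  rewrite /comb mulrzDl -!mulrzA -[p * j']mulrC [y *~ _]mulrzA -E -mulrzA -mulrzDr.
  by rewrite -{1}[x]mulr1z -B; congr (_ *~ _); ring.
have yE : y = comb x y q p *~ i'.
  rewrite /comb mulrzDl -!mulrzA [q * _]mulrC [x *~ _]mulrzA E -mulrzA -mulrzDr.
  by rewrite -{1}[y]mulr1z -B; congr (_ *~ _); ring.
move: xE yE; move: (comb x y q p) => t xE yE; rewrite xE yE.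
case: (primitive_int Px xE) => ->; case: (primitive_int Py yE) => ->;
  by rewrite ?mulrN1z ?mulr1z ?opprK; auto.
Qed.

Lemma half_line_primitive (N : zmodType) (NQ : lmodType rat)
    (iota : {additive N -> NQ}) (x y : N) : injective iota ->
  primitive x -> primitive y -> half_line (iota x) (iota y) -> x = y.
Proof.
move=> iotaI Px Py [c c0 E].
have tf := torsion_free_lattice iotaI.
have d0 : denq c <> 0 by apply/eqP; rewrite denq_eq0.
have [|//|] := @parallel_primitive _ y x (denq c) (numq c) tf Py Px d0.
- apply: iotaI; rewrite !raddfMz /= E -!scaler_int scalerA mulrC.
  by rewrite -numqE.
move=> yE; move: E; rewrite yE raddfN => /eqP.
rewrite eq_sym -subr_eq0 opprK -{2}[iota x]scale1r -scalerDl scaler_eq0.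
case/orP=> [|/eqP]; first by rewrite addr_eq0 => /eqP cE; rewrite cE in c0.
by rewrite -(raddf0 iota) => /iotaI/(primitive_nz Px).
Qed.

Lemma independentQ (N : zmodType) (NQ : lmodType rat)
    (iota : {additive N -> NQ}) (x y : N) (b c : rat) : injective iota ->
  independent x y -> b *: iota x + c *: iota y = 0 -> b = 0 /\ c = 0.
Proof.
move=> iotaI indep E.
have [|bE cE] := indep (numq b * denq c) (numq c * denq b).
  apply: iotaI; rewrite /comb raddfD raddf0 !raddfMz /= -!scaler_int.
  rewrite !intrM !numqE.
  transitivity (((denq b)%:~R * (denq c)%:~R : rat) *: (b *: iota x + c *: iota y)).
    rewrite scalerDr !scalerA; congr (_ *: _ + _ *: _); ring.
  by rewrite E scaler0.
move/eqP: bE; move/eqP: cE.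
by rewrite !mulf_eq0 !denq_eq0 !orbF !numq_eq0 => /eqP-> /eqP->.
Qed.

(** * Cones and their ray generators *)

Lemma conic_hullZ (V : lmodType rat) (s : seq V) (b : rat) (x : V) :
  0 <= b -> conic_hull s x -> conic_hull s (b *: x).
Proof.
move=> b0 [c c0 ->]; exists (fun i => b * c i).
  by move=> i; rewrite mulr_ge0.
by rewrite scaler_sumr; apply: eq_bigr => i _; rewrite scalerA.
Qed.

Lemma conic_hullD (V : lmodType rat) (s : seq V) (x y : V) :
  conic_hull s x -> conic_hull s y -> conic_hull s (x + y).
Proof.
move=> [c c0 ->] [d d0 ->]; exists (fun i => c i + d i).
  by move=> i; rewrite addr_ge0.
by rewrite -big_split; apply: eq_bigr => i _; rewrite scalerDl.
Qed.

Lemma two_dim_coneZ (N : zmodType) (NQ : lmodType rat)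
    (iota : {additive N -> NQ}) (C : NQ -> Prop) (b : rat) (x : NQ) :
  two_dim_cone iota C -> 0 <= b -> C x -> C (b *: x).
Proof. by move=> [[s sE] _ _] b0 /sE Cx; apply/sE/conic_hullZ. Qed.

Lemma two_dim_coneD (N : zmodType) (NQ : lmodType rat)
    (iota : {additive N -> NQ}) (C : NQ -> Prop) (x y : NQ) :
  two_dim_cone iota C -> C x -> C y -> C (x + y).
Proof. by move=> [[s sE] _ _] /sE Cx /sE Cy; apply/sE/conic_hullD. Qed.

Lemma cone2P (N : zmodType) (NQ : lmodType rat) (iota : {additive N -> NQ})
    (x y : N) (p : NQ) :
  cone2 iota x y p <->
  exists b c : rat, [/\ 0 <= b, 0 <= c & p = b *: iota x + c *: iota y].
Proof.
split=> [[c c0 ->]|[b [c [b0 c0 ->]]]].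
  by exists (c 0%N), (c 1%N); rewrite !big_ord_recl big_ord0 addr0.
exists (fun i => if i is 0%N then b else c); first by case.
by rewrite !big_ord_recl big_ord0 addr0.
Qed.

(** Primitive vectors in relation are equal or opposite: distinctness of the ray
    generators excludes the former, strict convexity the latter. *)
Lemma rays_independent (N : zmodType) (NQ : lmodType rat)
    (iota : {additive N -> NQ}) (C : NQ -> Prop) (u v : N) : injective iota ->
  two_dim_cone iota C -> ray_generators iota C u v -> independent u v.
Proof.
move=> iotaI [_ convex _] [[Pu Cu _] [Pv Cv _] uv] i j.
have tf := torsion_free_lattice iotaI.
have [-> {i}|/eqP i0] := eqVneq i 0.
  rewrite /comb mulr0z add0r; have [-> //|/eqP j0] := eqVneq j 0.
  by move/(tf _ _ j0)/(primitive_nz Pv).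
move/eqP; rewrite addr_eq0 -mulrNz => /eqP.
case/(parallel_primitive tf Pu Pv i0) => // uE.
have := convex _ Cv; rewrite -raddfN -uE => /(_ Cu).
by rewrite -(raddf0 iota) => /iotaI/(primitive_nz Pv).
Qed.

(** A third ray generator is impossible.  If t has a negative coordinate, then
    moving that term to the side of t exhibits a nonnegative multiple of the
    other generator as a sum of elements of C, and the ray of that generator is
    a face, hence contains t (or else C contains a line).  If t has nonnegative
    coordinates, then the ray of t is a face that contains the two terms. *)
Lemma ray_generator_cases (N : zmodType) (NQ : lmodType rat)
    (iota : {additive N -> NQ}) (C : NQ -> Prop) (u v t : N) (b c : rat) :
    injective iota -> two_dim_cone iota C -> ray_generators iota C u v ->
    ray_generator iota C t -> iota t = b *: iota u + c *: iota v ->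
  t = u \/ t = v.
Proof.
move=> iotaI dimC [[Pu Cu fu] [Pv Cv fv] uv] [Pt Ct ft] tE.
have self (x : NQ) : half_line x x by exists 1; rewrite ?scale1r.
have CZ := @two_dim_coneZ _ _ _ _ _ _ dimC.
have unscale (x y : N) (d : rat) : primitive x -> primitive y -> 0 < d ->
    half_line (iota x) (d *: iota y) -> x = y.
  move=> Px Py d0 [e e0 E]; apply: (half_line_primitive iotaI Px Py).
  exists (d^-1 * e); first by rewrite mulr_ge0 // invr_ge0 ltW.
  by rewrite -scalerA -E scalerA mulVf ?scale1r // gt_eqF.
have [b0|b0] := ltP b 0.
  have Cbu : C (- b *: iota u) by apply: CZ; rewrite // oppr_ge0 ltW.
  have E : iota t + (- b) *: iota u = c *: iota v.
    by rewrite tE scaleNr addrAC addrN add0r.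
  have [c0|c0] := ltP 0 c.
    right; apply/esym/(half_line_primitive iotaI Pv Pt).
    by apply: (fv _ _ Ct Cbu _).1; rewrite E; exists c; rewrite ?ltW.
  have [_ convex _] := dimC.
  have Ccv : C (- c *: iota v) by apply: CZ; rewrite // oppr_ge0.
  have /eqP : - b *: iota u = 0.
    apply: (convex _ Cbu); rewrite -scaleNr opprK.
    have -> : b *: iota u = iota t + - c *: iota v by rewrite tE scaleNr addrK.
    exact: (two_dim_coneD dimC Ct Ccv).
  rewrite scaler_eq0 oppr_eq0 (lt_eqF b0) => /eqP.
  by rewrite -(raddf0 iota) => /iotaI/(primitive_nz Pu).
have [c0|c0] := ltP c 0.
  have Ccv : C (- c *: iota v) by apply: CZ; rewrite // oppr_ge0 ltW.
  have E : iota t + (- c) *: iota v = b *: iota u.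
    by rewrite tE scaleNr addrK.
  left; apply/esym/(half_line_primitive iotaI Pu Pt).
  by apply: (fu _ _ Ct Ccv _).1; rewrite E; exists b.
have [hu hv] := ft _ _ (CZ _ _ b0 Cu) (CZ _ _ c0 Cv)
  (eq_ind _ (half_line _) (self _) _ tE).
have [b1|b1] := ltP 0 b; first by left; apply: (unscale _ _ b).
have [c1|c1] := ltP 0 c; first by right; apply: (unscale _ _ c).
case: (primitive_nz Pt); apply: iotaI; rewrite raddf0 tE.
have -> : b = 0 by apply/eqP; rewrite eq_le b0 b1.
have -> : c = 0 by apply/eqP; rewrite eq_le c0 c1.
by rewrite !scale0r addr0.
Qed.

Lemma cone2_rays (N : zmodType) (NQ : lmodType rat)
    (iota : {additive N -> NQ}) (x y : N) : injective iota ->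
  primitive x -> primitive y -> independent x y ->
  two_dim_cone iota (cone2 iota x y) /\
  ray_generators iota (cone2 iota x y) x y.
Proof.
move=> iotaI Px Py indep.
have Q0 := independentQ iotaI indep.
have Cx : cone2 iota x y (iota x).
  by apply/cone2P; exists 1, 0; rewrite scale1r scale0r addr0.
have Cy : cone2 iota x y (iota y).
  by apply/cone2P; exists 0, 1; rewrite scale1r scale0r add0r.
have add0 (b b' : rat) : 0 <= b -> 0 <= b' -> b + b' = 0 -> b = 0 /\ b' = 0.
  move=> b0 b'0 /eqP; rewrite paddr_eq0 // => /andP[/eqP-> /eqP->].
  by [].
split.
  split; first by exists [:: x; y].
    move=> p /cone2P[b [c [b0 c0 pE]]] /cone2P[b' [c' [b'0 c'0 p'E]]].
    have /Q0[bE cE] : (b + b') *: iota x + (c + c') *: iota y = 0.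
      by rewrite !scalerDl addrACA -pE -p'E subrr.
    have [bE0 _] := add0 _ _ b0 b'0 bE; have [cE0 _] := add0 _ _ c0 c'0 cE.
    by rewrite pE bE0 cE0 !scale0r addr0.
  by exists (iota x), (iota y).
split; last first.
- move=> xy; have [] := indep 1 (- 1); last by [].
  by rewrite /comb mulr1z mulrN1z xy subrr.
- split=> // p q /cone2P[b [c [b0 c0 pE]]] /cone2P[b' [c' [b'0 c'0 qE]]].
  move=> [t t0]; rewrite pE qE addrACA -!scalerDl => E.
  have /Q0[/(add0 _ _ b0 b'0)[-> ->] _] :
      (b + b') *: iota x + (c + c' - t) *: iota y = 0.
    by rewrite [_ *: iota y]scalerBl addrA E subrr.
  by rewrite !scale0r !add0r; split; [exists c | exists c'].
- split=> // p q /cone2P[b [c [b0 c0 pE]]] /cone2P[b' [c' [b'0 c'0 qE]]].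
  move=> [t t0]; rewrite pE qE addrACA -!scalerDl => E.
  have /Q0[_ /(add0 _ _ c0 c'0)[-> ->]] :
      (b + b' - t) *: iota x + (c + c') *: iota y = 0.
    by rewrite [_ *: iota x]scalerBl addrAC E subrr.
  by rewrite !scale0r !addr0; split; [exists b | exists b'].
Qed.

(** * Singularity types in integer coordinates *)

Lemma type_generatesP (N : zmodType) (NQ : lmodType rat)
    (iota : {additive N -> NQ}) (x y : N) (r : nat) (p q : int) :
  injective iota -> (0 < r)%N ->
  type_generates iota x y r p q <->
  exists z, z *~ r = comb x y p q /\
    forall t, exists i j k : int, t = x *~ i + y *~ j + z *~ k.
Proof.
move=> iotaI r0.
have rQ : (r%:R : rat) != 0 by rewrite pnatr_eq0 -lt0n.
suff relP z : iota z = (p%:~R / r%:R) *: iota x + (q%:~R / r%:R) *: iota y <->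
    z *~ r = comb x y p q.
  by split=> -[z [zE gen]]; exists z; split=> //; apply/relP.
split=> [E|/(congr1 iota)].
  apply: iotaI; rewrite raddfMz /= E /comb raddfD !raddfMz /= -!scaler_int.
  rewrite scalerDr !scalerA; congr (_ *: _ + _ *: _); rewrite mulrC mulfVK //.
rewrite /comb raddfD !raddfMz /= -!scaler_int => E.
have rQ' : (r%:Z%:~R : rat) != 0 by [].
transitivity ((r%:Z%:~R : rat)^-1 *: (r%:Z%:~R *: iota z)).
  by rewrite scalerA mulVf // scale1r.
rewrite E scalerDr !scalerA.
by congr (_ *: _ + _ *: _); rewrite mulrC.
Qed.

Lemma type_generatesC (N : zmodType) (NQ : lmodType rat)
    (iota : {additive N -> NQ}) (x y : N) (r : nat) (p q : int) :
  type_generates iota x y r p q -> type_generates iota y x r q p.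
Proof.
move=> [z [zE gen]]; exists z; split; first by rewrite addrC.
by move=> t; have [i [j [k ->]]] := gen t; exists j, i, k; rewrite [y *~ j + _]addrC.
Qed.

Lemma ray_generatorsC (N : zmodType) (NQ : lmodType rat)
    (iota : {additive N -> NQ}) (C : NQ -> Prop) (u v : N) :
  ray_generators iota C u v -> ray_generators iota C v u.
Proof. by move=> [ru rv uv]; split=> // /esym. Qed.

(** The type presentation serves to know that u and v span N rationally. *)
Lemma ray_generators_cases (N : zmodType) (NQ : lmodType rat)
    (iota : {additive N -> NQ}) (C : NQ -> Prop) (u v u' v' : N)
    (r : nat) (p q : int) :
    injective iota -> two_dim_cone iota C -> type_generates iota u v r p q ->
    ray_generators iota C u v -> ray_generators iota C u' v' ->
  (u' = u /\ v' = v) \/ (u' = v /\ v' = u).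
Proof.
move=> iotaI dimC [z [zE gen]] uv [ru' rv' u'v'].
have span t : exists b c, iota t = b *: iota u + c *: iota v.
  have [i [j [k ->]]] := gen t; rewrite !raddfD !raddfMz /= zE -!scaler_int.
  exists (i%:~R + k%:~R * (p%:~R / r%:R)), (j%:~R + k%:~R * (q%:~R / r%:R)).
  by rewrite scalerDr !scalerA addrACA -!scalerDl.
have [[b [c u'E]] [b' [c' v'E]]] := (span u', span v').
have := ray_generator_cases iotaI dimC uv ru' u'E.
have := ray_generator_cases iotaI dimC uv rv' v'E.
by case=> vE; case=> uE; auto; case: u'v'; rewrite uE vE.
Qed.

Lemma comb_clear_denominator (N : zmodType) (x y z : N) (R i j k P Q : int) :
  z *~ R = comb x y P Q ->
  (comb x y i j + z *~ k) *~ R = comb x y (i * R + P * k) (j * R + Q * k).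
Proof. by move=> zE; rewrite mulrzDl mulrzAC zE !combE. Qed.

(** The type 1/R (P, Q) determines the coordinates of the lattice points with
    respect to x and y, so any second presentation of N in terms of x and y is
    carried over to x' and y' by the same coefficients. *)
Lemma type_generates_transfer (N : zmodType) (NQ : lmodType rat)
    (iota : {additive N -> NQ}) (x y x' y' : N) (R r : nat) (P Q p q : int) :
    injective iota -> independent x y -> (0 < R)%N -> (0 < r)%N ->
    type_generates iota x y R P Q -> type_generates iota x' y' R P Q ->
  type_generates iota x y r p q -> type_generates iota x' y' r p q.
Proof.
move=> iotaI indep R0 r0.
have tf := torsion_free_lattice iotaI.
move/(type_generatesP _ _ _ _ iotaI R0) => [Z [ZE genZ]].
move/(type_generatesP _ _ _ _ iotaI R0) => [Z' [Z'E genZ']].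
move/(type_generatesP _ _ _ _ iotaI r0) => [z [zE genz]].
have [i [j [k zZ]]] := genZ z; rewrite -/(comb x y i j) in zZ.
have [i' [j' [k' Zz]]] := genz Z; rewrite -/(comb x y i' j') in Zz.
have RZ0 : R%:Z <> 0 by lia.
have rZ0 : r%:Z <> 0 by lia.
have [e1 e2] : p * R = (i * R + P * k) * r /\ q * R = (j * R + Q * k) * r.
  apply: (comb_inj indep); rewrite -!combMz -(comb_clear_denominator _ _ _ ZE).
  by rewrite -zZ -zE mulrzAC.
have [f1 f2] : P * r = (i' * r + p * k') * R /\ Q * r = (j' * r + q * k') * R.
  apply: (comb_inj indep); rewrite -!combMz -(comb_clear_denominator _ _ _ zE).
  by rewrite -Zz -ZE mulrzAC.
pose z' := comb x' y' i j + Z' *~ k.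
have z'E : z' *~ r = comb x' y' p q.
  apply: (mulIz tf RZ0).
  by rewrite mulrzAC (comb_clear_denominator _ _ _ Z'E) !combMz -e1 -e2.
have Z'z' : Z' = comb x' y' i' j' + z' *~ k'.
  apply: (mulIz tf rZ0); apply: (mulIz tf RZ0).
  by rewrite (comb_clear_denominator _ _ _ z'E) mulrzAC Z'E !combMz -f1 -f2.
apply/(type_generatesP _ _ _ _ iotaI r0); exists z'; split=> // t.
have [I [J [K ->]]] := genZ' t.
exists (I + i' * K), (J + j' * K), (k' * K).
rewrite {1}Z'z' mulrzDl -mulrzA addrA; congr (_ + _).
by rewrite -[LHS]/(comb x' y' I J + _) !combE.
Qed.

Lemma singularity_type_transfer (N : zmodType) (NQ : lmodType rat)
    (iota : {additive N -> NQ}) (D D' : NQ -> Prop) (x y x' y' : N)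
    (R r : nat) (P Q p q : int) :
    injective iota -> (0 < R)%N ->
    two_dim_cone iota D' ->
    ray_generators iota D x y -> ray_generators iota D' x' y' ->
    type_generates iota x y R P Q -> type_generates iota x' y' R P Q ->
  singularity_type iota D r p q -> singularity_type iota D' r p q.
Proof.
move=> iotaI R0 dimD' rD rD' tD tD' [dimD r0 pr qr [u [v [ruv tuv]]]].
split=> //.
have indep := rays_independent iotaI dimD rD.
have [[uE vE]|[uE vE]] := ray_generators_cases iotaI dimD tD rD ruv;
  rewrite {}uE {}vE in tuv.
  by exists x', y'; split=> //; apply: (type_generates_transfer _ indep R0 r0 tD).
exists y', x'; split; first exact: ray_generatorsC.
exact: (type_generates_transfer iotaI (independentC indep) R0 r0
  (type_generatesC tD) (type_generatesC tD') tuv).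
Qed.

(** * Cones over segments in an adapted basis *)

Lemma basis_primitive (N : zmodType) (x z : N) : basis x z -> primitive x.
Proof.
move=> [indep gen] k y xE; have [i [j yE]] := gen y.
have [ik1 _] : 1 = i * k /\ 0 = j * k.
  by apply: (comb_inj indep); rewrite comb10 -combMz -yE -pmulrn -xE.
have : (k %| 1)%Z by apply/dvdzP; exists i.
by rewrite dvdz1 => /eqP.
Qed.

(** The map x |-> x + j l e, z |-> z + j c e is the transvection along e by the
    form that is j l at x and j c at z; this form vanishes at e = l z - c x, so
    e is fixed and the map has determinant 1. *)
Lemma basis_shear (N : zmodType) (x z : N) (c l j : int) : basis x z ->
  let e := comb x z (- c) l in
  let x' := x + e *~ (j * l) in
  let z' := z + e *~ (j * c) in
  basis x' z' /\ comb x' z' (- c) l = e.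
Proof.
move=> [indep gen] e x' z'.
have x'E : x' = comb x z (1 - c * (j * l)) (l * (j * l)).
  by rewrite /x' /e -[X in X + _](comb10 x z) !combE; congr comb; ring.
have z'E : z' = comb x z (- c * (j * c)) (1 + l * (j * c)).
  by rewrite /z' /e -[X in X + _](comb01 x z) !combE; congr comb; ring.
have combx'z' i k : comb x' z' i k =
    comb x z (i * (1 - c * (j * l)) - k * (c * (j * c)))
             (i * (l * (j * l)) + k * (1 + l * (j * c))).
  by rewrite {1}/comb x'E z'E !combE; congr comb; ring.
split; last by rewrite combx'z' /e; congr comb; ring.
split.
  move=> i k; rewrite combx'z'.
  set A := _ - _; set B := _ + _ => /indep[A0 B0].
  have -> : i = A * (1 + l * (j * c)) + B * (c * (j * c)) by rewrite /A /B; ring.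
  have -> : k = B * (1 - c * (j * l)) - A * (l * (j * l)) by rewrite /A /B; ring.
  by rewrite A0 B0; split; ring.
move=> t; have [i [k ->]] := gen t.
exists (i * (1 + l * (j * c)) + k * (c * (j * c))).
exists (k * (1 - c * (j * l)) - i * (l * (j * l))).
by rewrite combx'z'; congr comb; ring.
Qed.

(** Since e = l z - c x, the relation k l z = (k c - 1) x + y holds, and x and z
    generate N. *)
Lemma cone_over_step (N : zmodType) (NQ : lmodType rat)
    (iota : {additive N -> NQ}) (x y z : N) (c : int) (k l : nat) :
    injective iota -> basis x z -> primitive y -> (0 < k)%N -> (0 < l)%N ->
    y = x + comb x z (- c) l *~ k ->
  [/\ primitive x, independent x y
    & type_generates iota x y (k * l) (k%:Z * c - 1) 1].
Proof.
move=> iotaI bxz Py k0 l0 yE; have [indep gen] := bxz.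
have yE' : y = comb x z (1 - c * k) (l%:Z * k).
  by rewrite yE -[X in X + _](comb10 x z) !combE; congr comb; ring.
have combxy i j : comb x y i j = comb x z (i + j * (1 - c * k)) (j * (l%:Z * k)).
  by rewrite {1}/comb yE' -{1}(comb10 x z) !combE; congr comb; ring.
split; first exact: basis_primitive bxz.
  move=> i j; rewrite combxy => /indep[iE jE].
  have j0 : j = 0 by nia.
  by rewrite j0 mul0r addr0 in iE.
apply/type_generatesP; rewrite ?muln_gt0 ?k0 //.
exists z; split.
  rewrite combxy -[in LHS](comb01 x z) !combE; congr comb; rewrite ?PoszM; ring.
move=> t; have [i [j ->]] := gen t.
by exists i, 0, j; rewrite mulr0z addr0.
Qed.

Lemma singularity_type_cone2 (N : zmodType) (NQ : lmodType rat)
    (iota : {additive N -> NQ}) (x y : N) (r : nat) (p : int) :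
    injective iota -> primitive x -> primitive y -> independent x y ->
    (0 < r)%N -> coprimez p r -> type_generates iota x y r p 1 ->
  singularity_type iota (cone2 iota x y) r 1 p /\
  singularity_type iota (cone2 iota y x) r 1 p.
Proof.
move=> iotaI Px Py indep r0 pr gen.
have cop1 : coprimez 1 r by rewrite /coprimez gcd1z.
have genC := type_generatesC gen.
have [d1 g1] := cone2_rays iotaI Px Py indep.
have [d2 g2] := cone2_rays iotaI Py Px (independentC indep).
by split; split=> //; exists y, x; split=> //; apply: ray_generatorsC.
Qed.

(** Deals with C_m when rho = 0: it is then a half-line and has no type. *)
Lemma two_dim_cone2_irrefl (N : zmodType) (NQ : lmodType rat)
    (iota : {additive N -> NQ}) (x : N) : ~ two_dim_cone iota (cone2 iota x x).
Proof.
move=> [_ _ [p [q [/cone2P[b [c [b0 c0 pE]]] /cone2P[b' [c' [_ _ qE]]] indep]]]].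
rewrite -scalerDl in pE; rewrite -scalerDl in qE.
have [_ /eqP] : b' + c' = 0 /\ - (b + c) = 0.
  apply: indep; rewrite pE qE !scalerA -scalerDl.
  by rewrite mulNr [X in _ - X]mulrC subrr scale0r.
rewrite oppr_eq0 => /eqP bc0.
have [] := indep 1 0; last by [].
by rewrite pE bc0 !scale0r scaler0 addr0.
Qed.

(** Dividing the values of h by g gives an additive form, of which h is the
    g-th multiple. *)
Lemma primitive_form_gcd (N : zmodType) (h : {additive N -> int}) (g : int) :
  primitive_form h -> 0 < g -> (forall t, g %| h t)%Z -> g = 1.
Proof.
move=> Ph g0 gh.
pose f t := (h t %/ g)%Z.
have fB : zmod_morphism f.
  move=> s t; apply: (mulIf (x := g)); first by rewrite gt_eqF.
  by rewrite mulrBl !divzK // raddfB.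
pose F : {additive N -> int} := HB.pack f (GRing.isZmodMorphism.Build N int f fB).
have := Ph `|g|%N F; rewrite /= => H.
have : `|g|%N = 1%N; last lia.
apply: H => t; rewrite /f -{1}(divzK (gh t)) pmulrn -mulrzz.
by congr (_ *~ _); lia.
Qed.

(** * The normal form of a cone *)

Lemma type_generates_basis (N : zmodType) (NQ : lmodType rat)
    (iota : {additive N -> NQ}) (u v : N) (r : nat) (p : int) :
    injective iota -> (0 < r)%N -> independent u v ->
    type_generates iota u v r p 1 ->
  exists2 z, basis u z & v = comb u z (- p) r.
Proof.
move=> iotaI r0 indep /(type_generatesP _ _ _ _ iotaI r0)[z [zE gen]].
have vE : v = comb u z (- p) r.
  by rewrite /comb zE /comb mulrNz addrA addNr add0r mulr1z.
exists z => //; split.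
  move=> i j E.
  have [] : i * r%:Z + p * j = 0 /\ 0 * r%:Z + 1 * j = 0; last first.
    by rewrite mul0r add0r mul1r => + j0; rewrite j0 mulr0 addr0; nia.
  apply: indep; rewrite -(comb_clear_denominator _ _ _ zE).
  by rewrite {1}/comb mulr0z addr0 -/(comb u z i j) E mul0rz.
move=> t; have [i [j [k ->]]] := gen t.
exists (i - p * j), (k + r%:Z * j).
have -> : u *~ i = comb u z i 0 by rewrite /comb mulr0z addr0.
have -> : z *~ k = comb u z 0 k by rewrite /comb mulr0z add0r.
by rewrite vE !combE; congr comb; ring.
Qed.

(** If p p' = 1 + q r, then z' = p' z - q u satisfies r z' = u + p' v, and
    conversely z = p z' - q v. *)
Lemma type_generates_swap (N : zmodType) (NQ : lmodType rat)
    (iota : {additive N -> NQ}) (u v : N) (r : nat) (p p' : int) :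
    injective iota -> (0 < r)%N -> (p * p' = 1 %[mod r])%Z ->
    type_generates iota u v r p 1 ->
  type_generates iota v u r p' 1.
Proof.
move=> iotaI r0 /eqP; rewrite eqz_mod_dvd => /dvdzP[q qE].
move/(type_generatesP _ _ _ _ iotaI r0)=> [z [zE gen]].
have {}qE : p * p' = 1 + q * r by rewrite -qE; ring.
apply/(type_generatesP _ _ _ _ iotaI r0).
have tf := torsion_free_lattice iotaI.
have rZ0 : r%:Z <> 0 by lia.
pose z' := comb u v (- q) 0 + z *~ p'.
have z'E : z' *~ r = comb u v 1 p'.
  by rewrite (comb_clear_denominator _ _ _ zE) qE; congr comb; ring.
exists z'; split; first by rewrite z'E /comb addrC.
have zz' : z = comb u v 0 (- q) + z' *~ p.
  apply: (mulIz tf rZ0); rewrite (comb_clear_denominator _ _ _ z'E) zE.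
  by congr comb; [|rewrite [p' * p]mulrC qE]; ring.
move=> t; have [i [j [k ->]]] := gen t.
exists (j - q * k), i, (p * k).
rewrite {1}zz' mulrzDl -mulrzA addrA; congr (_ + _).
rewrite -/(comb u v i j) addrC -[RHS]addrC -/(comb u v i (j - q * k)) !combE.
by congr comb; ring.
Qed.

(** Let e = i u + j z be the primitive vector with v - u = w e, where
    v - u = r z - a u; so -a = i w and r = j w.  Since h is constant on the
    segment, h(e) = 0, that is j h(z) = - i l.  Here i and j are coprime because
    e is primitive, and l and h(z) are coprime because h is primitive with
    h(u) = l; hence j = l. *)
Lemma cone_normal_form (N : zmodType) (NQ : lmodType rat)
    (iota : {additive N -> NQ}) (u v : N) (r w l : nat) (a : int)
    (h : {additive N -> int}) :
    injective iota -> (0 < r)%N -> (0 < l)%N -> independent u v ->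
    type_generates iota u v r (a - 1) 1 -> lattice_length (v - u) w ->
    primitive_form h -> h u = l -> h v = l ->
  exists z c, [/\ basis u z, a = w%:Z * c, r = (w * l)%N,
    primitive (comb u z (- c) l) & v = u + comb u z (- c) l *~ w].
Proof.
move=> iotaI r0 l0 indep gen [e Pe vuE] Ph hu hv.
have [z buz vE] := type_generates_basis iotaI r0 indep gen.
have [iuz guz] := buz.
have [i [j eE]] := guz e.
have [aE rE] : - a = i * w /\ r%:Z = j * w.
  apply: (comb_inj iuz); rewrite -combMz -eE -pmulrn -vuE vE -{3}(comb10 u z).
  by rewrite !combE; congr comb; ring.
have wpos : 0 < w%:Z.
  have [w0|//] := posnP w.
  by move: rE; rewrite w0 mulr0 => -[r_eq0]; rewrite r_eq0 in r0.
have cop_ij : gcdz i j = 1.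
  have g0 : 0 < gcdz i j.
    by rewrite lt_def gcdz_eq0 andbT; apply/negP => /andP[_ /eqP]; nia.
  have := Pe `|gcdz i j|%N (comb u z (i %/ gcdz i j)%Z (j %/ gcdz i j)%Z).
  rewrite pmulrn combMz abszE gtr0_norm // !divzK ?dvdz_gcdl ?dvdz_gcdr //.
  by move=> /(_ eE); lia.
have cop_lh : gcdz l (h z) = 1.
  apply: (primitive_form_gcd Ph).
    by rewrite lt_def gcdz_eq0 andbT; apply/negP => /andP[/eqP]; lia.
  move=> t; have [i' [j' ->]] := guz t.
  rewrite /comb raddfD !raddfMz /= hu !mulrzz.
  by rewrite rpredD // dvdz_mulr ?dvdz_gcdl ?dvdz_gcdr.
have hzE : h z * j = - i * l.
  move: hv; rewrite vE /comb raddfD !raddfMz /= hu !mulrzz => E.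
  have {}E : l%:Z * - (a - 1) + h z * r%:Z = l%:Z := E.
  apply: (mulIf (lt0r_neq0 wpos)); rewrite -mulrA -rE.
  have -> : - i * l * w = - (i * w) * l by ring.
  by rewrite -aE; lia.
(* j and l divide each other, by the two coprimality relations. *)
have jl : j = l.
  have jpos : 0 < j by rewrite -(pmulr_lgt0 j wpos) -rE.
  have jDl : (j %| l%:Z)%Z.
    by rewrite -(@Gauss_dvdzr _ (- i)) -?hzE ?dvdz_mull // /coprimez gcdzN gcdzC cop_ij.
  have lDj : (l%:Z %| j)%Z.
    by rewrite -(@Gauss_dvdzr _ (h z)) ?hzE ?dvdz_mull // /coprimez cop_lh.
  have : `|j|%N = l by apply/eqP; rewrite eqn_dvd; apply/andP; split.
  by lia.
exists z, (- i); rewrite opprK -jl -eE; split=> //; try nia.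
by rewrite -pmulrn -vuE addrC subrK.
Qed.

(** * The subdivision *)

Lemma half_line_multiple (N : zmodType) (NQ : lmodType rat)
    (iota : {additive N -> NQ}) (e d : N) (w k : nat) : injective iota ->
  primitive e -> half_line (iota (e *~ w)) (iota d) -> lattice_length d k ->
  d = e *~ k.
Proof.
move=> iotaI Pe [b b0 E] [y Py dE].
have [k0|k0] := posnP k; first by rewrite dE k0 mulr0n.
have kQ : (k%:R : rat) != 0 by rewrite pnatr_eq0 -lt0n.
rewrite dE -pmulrn; congr (_ *+ _); apply/esym.
apply: (half_line_primitive iotaI Pe Py); exists (k%:R^-1 * b * w%:R).
  by rewrite !mulr_ge0 ?invr_ge0.
rewrite -!scalerA [w%:R *: _]scaler_nat -raddfMn [e *+ w]pmulrn -E dE raddfMn.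
by rewrite -scaler_nat scalerA mulVf ?scale1r.
Qed.

Lemma subdivision_points (N : zmodType) (NQ : lmodType rat)
    (iota : {additive N -> NQ}) (l n rho m w : nat) (u v e : N) (s : nat -> N) :
    injective iota -> primitive e -> v = u + e *~ w -> (m <= n)%N ->
    subdivision iota l n rho m u v s ->
  forall i, (i <= n.+1)%N ->
    s i = u + e *~ (if (i <= m)%N then i * l else i.-1 * l + rho)%N.
Proof.
move=> iotaI Pe vE mn [[s0 _] _ half len lenm].
have vuE : v - u = e *~ w by rewrite vE addrC addKr.
elim=> [_|i IH iN]; first by rewrite mul0n mulr0z addr0.
have hi := half i iN; rewrite vuE in hi.
rewrite -[s i.+1](subrK (s i)) addrC.
have [im|im] := eqVneq i m.
  have lenm' : lattice_length (s i.+1 - s i) rho by rewrite im.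
  rewrite (half_line_multiple iotaI Pe hi lenm') (IH (ltnW iN)).
  by rewrite -addrA -mulrzDr im leqnn ltnn.
rewrite (half_line_multiple iotaI Pe hi (len i iN (elimN eqP im))) (IH (ltnW iN)).
rewrite -addrA -mulrzDr; congr (_ + _ *~ _); rewrite -PoszD; congr Posz.
by case: (ltngtP i m) im => // im _; rewrite ?mulSn; nia.
Qed.

Lemma leq_of_ratio (m w l n rho : nat) : (rho < l)%N -> w = (n * l + rho)%N ->
  m%:R <= w%:R / l%:R :> rat -> (m <= n)%N.
Proof.
move=> rhol wE; have l0 : (0 < l)%N by lia.
rewrite ler_pdivlMr ?ltr0n // -natrM ler_nat; nia.
Qed.

Lemma lattice_lengthC (N : zmodType) (x y : N) (k : nat) :
  lattice_length (x - y) k -> lattice_length (y - x) k.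
Proof.
move=> [d Pd dE]; exists (- d); first exact: primitiveN.
by rewrite mulNrn -dE opprB.
Qed.

(** The step of length k may start at any x = u + j l e, since the shear moves
    the basis u, z to one that starts with x. *)
Lemma cone_on_segment (N : zmodType) (NQ : lmodType rat)
    (iota : {additive N -> NQ}) (u z x y : N) (c j : int) (k l : nat) :
    injective iota -> basis u z -> (0 < k)%N -> (0 < l)%N -> primitive y ->
    x = u + comb u z (- c) l *~ (j * l) -> y = x + comb u z (- c) l *~ k ->
  [/\ primitive x, independent x y
    & type_generates iota x y (k * l) (k%:Z * c - 1) 1].
Proof.
move=> iotaI buz k0 l0 Py xE yE.
have [bx eE] := basis_shear c l j buz; rewrite -xE in bx eE.
by apply: (cone_over_step iotaI bx Py k0 l0); rewrite eE.
Qed.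

Theorem proposition2p3 (N : zmodType) (NQ : lmodType rat)
    (iota : {additive N -> NQ})
    (hN : rank_two_lattice N) (hNQ : is_rationalization iota)
    (C : NQ -> Prop) (r : nat) (a abar : int) (w l n rho m : nat)
    (u v : N) (s : nat -> N)
    (hC : singularity_type iota C r 1 (a - 1))
    (hw : cone_width iota C w) (hl : local_index iota C l)
    (hdiv : w = (n * l + rho)%N) (hrho : (rho < l)%N)
    (huv : ray_generators iota C u v)
    (hgen : type_generates iota u v r (a - 1) 1)
    (hm : m%:R <= w%:R / l%:R :> rat)
    (hs : subdivision iota l n rho m u v s)
    (habar : ((a - 1) * (abar - 1) = 1 %[mod r%:Z])%Z) :
  [/\ (* (1) *)
      forall i, (i <= n.+1)%N -> primitive (s i),
      (* (2) *)
      forall i, (i < m)%N ->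
        singularity_type iota (cone2 iota (s i) (s i.+1))
          (l ^ 2) 1 ((l%:Z * a %/ w%:Z)%Z - 1),
      (* (3) *)
      rho <> 0%N ->
        singularity_type iota (cone2 iota (s m) (s m.+1))
          (rho * l) 1 ((rho%:Z * a %/ w%:Z)%Z - 1),
      (* (4) *)
      forall i, (m < i <= n)%N ->
        singularity_type iota (cone2 iota (s i) (s i.+1))
          (l ^ 2) 1 ((l%:Z * abar %/ w%:Z)%Z - 1)
    & (* the type of C_m depends only on C: it is independent of the order of
         the two ray generators and of m *)
      forall (u' v' : N) (m' : nat) (s' : nat -> N),
        ray_generators iota C u' v' ->
        m'%:R <= w%:R / l%:R :> rat ->
        subdivision iota l n rho m' u' v' s' ->
        same_singularity_type iota
          (cone2 iota (s m) (s m.+1)) (cone2 iota (s' m') (s' m'.+1))].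
Proof.
have iotaI := iota_inj hN hNQ.
have tf := torsion_free_lattice iotaI.
have [dimC r0 _ cop_ar _] := hC.
have l0 : (0 < l)%N := hl.1.
have [w0 [u1 [v1 [ruv1 len1]]]] := hw.
have [_ [u2 [v2 [h [ruv2 Ph hu2 hv2]]]]] := hl.
have rays := ray_generators_cases iotaI dimC hgen huv.
have len : lattice_length (v - u) w.
  case: (rays _ _ ruv1) => -[uE vE]; move: len1; rewrite uE vE => //.
  exact: lattice_lengthC.
have [hu hv] : h u = l /\ h v = l.
  by case: (rays _ _ ruv2) => -[uE vE]; rewrite uE vE in hu2 hv2.
have indep := rays_independent iotaI dimC huv.
have gen' := type_generates_swap iotaI r0 habar hgen.
have [z [c [buz aE rE Pe vE]]] :=
  cone_normal_form iotaI r0 l0 indep hgen len Ph hu hv.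
have [z' [c' [bvz' abarE _ _ uE]]] :=
  cone_normal_form iotaI r0 l0 (independentC indep) gen' (lattice_lengthC len) Ph hv hu.
set e := comb u z (- c) l in Pe vE.
set e' := comb v z' (- c') l in uE.
have e'E : e' = - e.
  have wZ : w%:Z <> 0 by lia.
  apply: (mulIz tf wZ); rewrite mulNrz; apply/eqP; rewrite -addr_eq0 addrC.
  by rewrite -(inj_eq (addrI u)) addrA -vE -uE addr0.
have Pfront (j : int) : primitive (u + e *~ (j * l)).
  by have [/basis_primitive] := basis_shear c l j buz.
have Pback (j : int) : primitive (v + e' *~ (j * l)).
  by have [/basis_primitive] := basis_shear c' l j bvz'.
have wlZ : w%:Z = n%:Z * l + rho by rewrite hdiv PoszD PoszM.
have back (j : int) : v + e' *~ (j * l) = u + e *~ ((n%:Z - j) * l + rho).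
  rewrite vE e'E mulNrz -mulrNz -addrA -mulrzDr; congr (_ + _ *~ _).
  by rewrite wlZ; ring.
have mn := leq_of_ratio hrho hdiv hm.
have pts := subdivision_points iotaI Pe vE mn hs.
have front_pt i : (i <= m)%N -> s i = u + e *~ (i%:Z * l).
  by move=> im; rewrite pts ?im //; lia.
have back_pt i : (m < i <= n.+1)%N -> s i = v + e' *~ ((n.+1 - i)%:Z * l).
  move=> /andP[mi iN]; rewrite pts // leqNgt mi back; congr (_ + _ *~ _).
  rewrite PoszD PoszM; congr (_ * _ + _); lia.
have smS : s m.+1 = s m + e *~ rho.
  by rewrite !pts // ?leqnn ?ltnn //; [rewrite -addrA -mulrzDr | lia].
have prim i : (i <= n.+1)%N -> primitive (s i).
  move=> iN; have [im|mi] := leqP i m; first by rewrite front_pt.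
  by rewrite back_pt ?mi.
have cop_l (d : int) : coprimez (l%:Z * d - 1) (l * l)%N.
  rewrite PoszM coprimezMr andbb; apply/coprimezP; exists (- 1, d) => /=; ring.
(* Modulo l, rho is congruent to w, and w c - 1 = a - 1 is a unit modulo r = w l. *)
have cop_rho : coprimez (rho%:Z * c - 1) (rho * l)%N.
  rewrite PoszM coprimezMr; apply/andP; split.
    by apply/coprimezP; exists (- 1, c) => /=; ring.
  move: cop_ar; rewrite rE PoszM coprimezMr => /andP[_ /coprimezP[[p q] /= pq]].
  apply/coprimezP; exists (p, q + p * n * c) => /=.
  by rewrite -[RHS]pq aE wlZ; ring.
have divE (k : nat) (d : int) : (k%:Z * (w%:Z * d) %/ w)%Z = k%:Z * d.
  by rewrite mulrCA mulKz //; lia.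
split=> //.
- move=> i im; have iN : (i < n.+1)%N by lia.
  have sS : s i.+1 = s i + e *~ l.
    rewrite !front_pt // 1?ltnW // -addrA -mulrzDr; congr (_ + _ *~ _).
    by rewrite intS; ring.
  have [Px indepi geni] := cone_on_segment iotaI buz l0 l0 (prim _ iN)
    (front_pt _ (ltnW im)) sS.
  rewrite aE divE -mulnn.
  by apply: (singularity_type_cone2 iotaI Px (prim _ iN) indepi _ _ geni).1;
    rewrite ?muln_gt0 ?l0.
- move=> rho0; have rho_gt0 : (0 < rho)%N by lia.
  have [Px indepm genm] := cone_on_segment iotaI buz rho_gt0 l0 (prim m.+1 mn)
    (front_pt _ (leqnn m)) smS.
  rewrite aE divE.
  by apply: (singularity_type_cone2 iotaI Px (prim m.+1 mn) indepm _ _ genm).1;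
    rewrite ?muln_gt0 ?l0 ?rho_gt0.
- move=> i /andP[mi iN].
  have mi1 : (m < i.+1 <= n.+1)%N by lia.
  have mi0 : (m < i <= n.+1)%N by lia.
  have Py : primitive (s i) by apply: prim; lia.
  have sS : s i = s i.+1 + e' *~ l.
    rewrite (back_pt _ mi0) (back_pt _ mi1) -addrA -mulrzDr; congr (_ + _ *~ _).
    rewrite (_ : (n.+1 - i)%N = (n.+1 - i.+1).+1); last lia.
    by rewrite intS; ring.
  have [Px indepi geni] := cone_on_segment iotaI bvz' l0 l0 Py
    (back_pt _ mi1) sS.
  rewrite abarE divE -mulnn.
  by apply: (singularity_type_cone2 iotaI Px Py indepi _ _ geni).2;
    rewrite ?muln_gt0 ?l0.
move=> u' v' m' s' ruv' hm' hs'.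
have mn' := leq_of_ratio hrho hdiv hm'.
have [rho0|rho_gt0] := posnP rho.
  have degenerate s0 m0 u0 v0 : subdivision iota l n rho m0 u0 v0 s0 ->
      s0 m0.+1 = s0 m0.
    by move=> [_ _ _ _ [y _ /eqP]]; rewrite rho0 mulr0n subr_eq0 => /eqP.
  rewrite (degenerate _ _ _ _ hs) (degenerate _ _ _ _ hs') => R p q.
  by split=> -[/two_dim_cone2_irrefl].
(* Seen from the u side, all candidates for C_m have one common type; y is
   primitive because it is at distance (n - j) l from v. *)
have middle (D : NQ -> Prop) x y (j : int) :
    D = cone2 iota x y \/ D = cone2 iota y x ->
    x = u + e *~ (j * l) -> y = x + e *~ rho ->
    j <= n ->
  [/\ two_dim_cone iota D, ray_generators iota D x y
    & type_generates iota x y (rho * l) (rho%:Z * c - 1) 1].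
  move=> DE xE yE jn.
  have Py : primitive y.
    have -> : y = v + e' *~ ((n%:Z - j) * l).
      by rewrite yE xE back -addrA -mulrzDr; congr (_ + _ *~ _); ring.
    exact: Pback.
  have [Px indepxy genxy] := cone_on_segment iotaI buz rho_gt0 l0 Py xE yE.
  have [dim1 ray1] := cone2_rays iotaI Px Py indepxy.
  have [dim2 ray2] := cone2_rays iotaI Py Px (independentC indepxy).
  by case: DE => ->; split=> //; apply: ray_generatorsC.
have [d1 ray1 gen1] := middle (cone2 iota (s m) (s m.+1)) (s m) (s m.+1) m
  (or_introl erefl) (front_pt _ (leqnn m))
  smS mn.
have [x [y [d2 ray2 gen2]]] : exists x y,
    [/\ two_dim_cone iota (cone2 iota (s' m') (s' m'.+1)),
       ray_generators iota (cone2 iota (s' m') (s' m'.+1)) x y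
     & type_generates iota x y (rho * l) (rho%:Z * c - 1) 1].
  have m'N : (m' <= n.+1)%N by lia.
  case: (rays _ _ ruv') => -[u'E v'E]; rewrite {}u'E {}v'E in hs'.
    have pts' := subdivision_points iotaI Pe vE mn' hs'.
    exists (s' m'), (s' m'.+1); apply: (middle _ _ _ m'); first by left.
    - by rewrite pts' // leqnn PoszM.
    - by rewrite !pts' // leqnn ltnn -addrA -mulrzDr.
    - by [].
  have Pe' : primitive e' by rewrite e'E; apply: primitiveN.
  have pts' := subdivision_points iotaI Pe' uE mn' hs'.
  (* Subdividing from v, the piece of length rho ends at distance (n - m') l
     from u. *)
  exists (s' m'.+1), (s' m'); apply: (middle _ _ _ (n%:Z - m'%:Z)); first by right.
  - rewrite pts' // ltnn /= vE e'E mulNrz -mulrNz -addrA -mulrzDr.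
    by congr (_ + _ *~ _); rewrite wlZ PoszD PoszM; ring.
  - rewrite !pts' // leqnn ltnn /= e'E !mulNrz -!mulrNz -addrA -mulrzDr.
    by congr (_ + _ *~ _); rewrite PoszD PoszM; ring.
  - by lia.
have Rl0 : (0 < rho * l)%N by rewrite muln_gt0 rho_gt0.
move=> R p q; split.
  exact: (singularity_type_transfer iotaI Rl0 d2 ray1 ray2 gen1 gen2).
exact: (singularity_type_transfer iotaI Rl0 d1 ray2 ray1 gen2 gen1).
Qed.
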